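(* Consider the 3D pendulum model on $TSO(3)\cong SO(3)\times\mathbb{R}^3$ $$J\dot\omega = J\omega\times\omega + mg\,\rho\times R^{T}e_3,\qquad \dot R = R\widehat{\omega}.$$ Then each equilibrium in the inverted equilibrium manifold $$\mathtt{I}=\Big\{(R,0)\in TSO(3): R^{T}e_3=-\frac{\rho}{\|\rho\|}\Big\}$$ is unstable.
   Context: The 3D pendulum is a rigid body with a fixed frictionless pivot under uniform gravity. $R\in SO(3)$ is its attitude, $\omega\in\mathbb{R}^3$ its body-fixed angular velocity, $J$ its constant symmetric positive definite inertia matrix (body frame, origin at the pivot), $m>0$ its mass, $g>0$ the gravitational acceleration, $\rho\in\mathbb{R}^3$, $\rho\neq0$, the body-fixed vector from the pivot to the center of mass, $e_3=(0,0,1)^T$. For $a\in\mathbb{R}^3$, $\widehat a$ is the skew-symmetric matrix with $\widehat a\,b=a\times b$. $TSO(3)$ is identified with $SO(3)\times\mathbb{R}^3$ via $(R,R\widehat\omega)\leftrightarrow(R,\omega)$. An equilibrium is unstable if it is not stable in the sense of Lyapunov. *)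

(* Defs.v *)
From HB Require Import structures.
From mathcomp Require Import all_boot all_order all_algebra.
From mathcomp Require Import all_classical all_reals all_analysis.
From mathcomp Require Import ring.

Set Implicit Arguments.
Unset Strict Implicit.
Unset Printing Implicit Defensive.

Import Order.TTheory GRing.Theory Num.Theory.
Import numFieldNormedType.Exports.

Local Open Scope classical_set_scope.
Local Open Scope ring_scope.

Section Vectors.
Variable R : realType.
Implicit Types a b v : 'cV[R]_3.

(* Rows of 'cV_3 are indexed by 'I_3 = Z/3, so the coordinates of v are
   v 0 0, v 1 0 and v 2 0. *)
Definition e3 : 'cV[R]_3 := delta_mx 2 0.

Definition cross a b : 'cV[R]_3 :=
  \col_(i < 3) [:: a 1 0 * b 2 0 - a 2 0 * b 1 0;
                   a 2 0 * b 0 0 - a 0 0 * b 2 0;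
                   a 0 0 * b 1 0 - a 1 0 * b 0 0]`_i.

(* The matrix of the linear map b |-> a x b: column j is a x e_j. *)
Definition hat a : 'M[R]_3 := \matrix_(i, j) cross a (delta_mx j 0) i 0.

Lemma hatE a b : hat a *m b = cross a b.
Proof.
have e1 : lift ord0 ord0 = 1 :> 'I_3 by apply/val_inj.
have e2 : lift ord0 (lift ord0 ord0) = 2 :> 'I_3 by apply/val_inj.
apply/colP => i; rewrite !mxE !big_ord_recl big_ord0 !mxE !e1 !e2.
by case: i => -[|[|[|//]]] ? /=; ring.
Qed.

Lemma hat_skew a : (hat a)^T = - hat a.
Proof.
apply/matrixP => i j; rewrite !mxE.
by case: i => -[|[|[|//]]] ?; case: j => -[|[|[|//]]] ? /=; ring.
Qed.

(* The norm `|v| that the library puts on matrices is the sup norm. *)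
Definition euclid_norm v : R := Num.sqrt (\sum_i v i 0 ^+ 2).

Definition sym_posdef (J : 'M[R]_3) : Prop :=
  J^T = J /\ forall v, v != 0 -> 0 < (v^T *m J *m v) 0 0.

Definition SO3 : set 'M[R]_3 := [set Q | Q^T *m Q = 1%:M /\ \det Q = 1].

End Vectors.

Arguments e3 {R}.
Arguments SO3 {R}.

Section Pendulum.
Variable R : realType.

(* A state (Q, w) is an attitude Q and a body-fixed angular velocity w; TSO3 is
   the state space, seen as a subset of a normed space. *)
Definition state : Type := ('M[R]_3 * 'cV[R]_3)%type.

Definition TSO3 : set state := [set x | SO3 x.1].

Variables (J : 'M[R]_3) (m g : R) (rho : 'cV[R]_3).

(* Forward solutions. Only the restriction of x to [0, +oo[ matters: a function
   on [0, +oo[ with a one-sided derivative at 0 extends affinely to t < 0, so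
   asking for a two-sided derivative at 0 is no restriction. *)
Definition trajectory (x : R -> state) : Prop :=
  forall t : R, 0 <= t ->
    let Q s := (x s).1 in
    let w s := (x s).2 in
    [/\ TSO3 (x t),
        derivable Q t 1,
        derivable w t 1,
        J *m derive1 w t
          = cross (J *m w t) (w t) + (m * g) *: cross rho ((Q t)^T *m e3)
      & derive1 Q t = Q t *m hat (w t)].

Definition equilibrium (x : state) : Prop := trajectory (fun=> x).

(* The norm on states is the max of the sup norms of the two components; it
   induces the topology of SO(3) x R^3. *)
Definition lyapunov_stable (x0 : state) : Prop :=
  forall eps : R, 0 < eps ->
  exists2 delta : R, 0 < delta &
  forall x : R -> state, trajectory x -> `|x 0 - x0| < delta ->
  forall t : R, 0 <= t -> `|x t - x0| < eps.

Definition unstable_equilibrium (x0 : state) : Prop :=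
  equilibrium x0 /\ ~ lyapunov_stable x0.

Definition inverted_equilibria : set state :=
  [set x | [/\ TSO3 x, x.2 = 0
             & x.1^T *m e3 = - ((euclid_norm rho)^-1 *: rho)]].

End Pendulum.

(* Main.v *)
(* Put n = rho / |rho|, c = m g |rho| and gamma = Q^T e3, so that gamma = - n at the
   equilibrium. The energy w.Jw / 2 - c n.gamma and the vertical momentum Jw.gamma are
   conserved. Start at the equilibrium attitude with a small velocity w(0) <> 0 such that
   Jw(0) is orthogonal to n; then Jw.gamma = 0 for all times, and w.Jw never falls below
   its initial value because - c n.gamma is maximal at the start. The virial function
   V = Jw.(n x gamma) satisfies
     V' = (Jw x w).(n x gamma) + c |n x gamma|^2 - (n.gamma) (w.Jw)
   and close to the equilibrium n.gamma is near -1 and the cubic term is dominated by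
   w.Jw, so V' stays above a positive constant although V is bounded. Hence the trajectory
   leaves a fixed neighbourhood.

   Global trajectories are obtained by multiplying the polynomial vector field by a
   compactly supported scalar factor phi. This makes it bounded and Lipschitz, and it
   preserves every conservation law, since phi only changes the speed along orbits. By
   conservation of Q Q^T and of the energy the orbit stays where phi = 1. *)

Require Import Defs.
From HB Require Import structures.
From mathcomp Require Import all_boot all_order all_algebra.
From mathcomp Require Import all_classical all_reals all_analysis.
From mathcomp Require Import ring lra.

Set Implicit Arguments.
Unset Strict Implicit.
Unset Printing Implicit Defensive.

Import Order.TTheory GRing.Theory Num.Theory.
Import numFieldNormedType.Exports.

Local Open Scope classical_set_scope.
Local Open Scope ring_scope.

(** * Picard iteration *)

Section Calculus.
Variable R : realType.
Implicit Types (f : R -> R) (s t : R).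

Lemma mean_value f (df : R -> R) s t : s <= t ->
    (forall c : R, s <= c <= t -> is_derive c 1 f (df c)) ->
  exists2 c, s <= c <= t & f t - f s = df c * (t - s).
Proof.
move=> st fP.
have [||c cst ->] := @MVT_segment R f df s t st.
- move=> c /[!in_itv]/= /andP[sc ct]; apply: fP.
  by rewrite (ltW sc) (ltW ct).
- apply: derivable_within_continuous => c /[!in_itv]/= cst.
  exact: (@ex_derive _ _ _ _ _ _ _ (fP _ cst)).
- by exists c => //; move: cst; rewrite in_itv.
Qed.

Lemma continuous_primitive f : continuous f ->
  exists2 P : R -> R, P 0 = 0 & forall t, -1 < t -> is_derive t 1 P (f t).
Proof.
move=> cf.
pose A (t : R) : R := \int[@lebesgue_measure R]_(u in `[(-1 : R), t]) f u.
exists (fun t => A t - A 0); first by rewrite subrr.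
move=> t t1.
(* The right end [t + 1] makes [t] interior, so the derivative is two-sided. *)
have [||||dA A't] := @continuous_FTC1_closed R f (-1) t (t + 1).
- by rewrite ltrDl.
- apply: continuous_compact_integrable; first exact: segment_compact.
  exact: continuous_subspaceT.
- exact: t1.
- exact: cf.
have At : is_derive t 1 A (f t).
  by apply: DeriveDef; [exact: dA | rewrite -derive1E; exact: A't].
by apply: is_derive_eq; rewrite subr0.
Qed.

Lemma is_derive_quadratic f t (l C r : R) : 0 < r ->
    (forall s, t - r < s -> `|f s - f t - (s - t) * l| <= C * (s - t) ^+ 2) ->
  is_derive t 1 f l.
Proof.
move=> r0 fP.
have fl : h^-1 *: (f (h *: 1 + t) - f t) @[h --> (0 : R)^'] --> l.
  apply/cvgrPdist_le => /= e e0.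
  near=> h.
  have h0 : h != 0 by near: h; exact: nbhs_dnbhs_neq.
  have hr : `|h| < r by near: h; exact: dnbhs0_lt.
  have hC : `|h| <= e / (`|C| + 1).
    by near: h; apply: dnbhs0_le; rewrite divr_gt0 // ltr_wpDl.
  have hlt : t - r < h + t.
    by move: hr; rewrite ltr_norml => /andP[hr _]; lra.
  have := fP _ hlt; rewrite addrK => fh.
  rewrite [h *: 1]mulr1 distrC.
  have h1 : 0 < `|h| by rewrite normr_gt0.
rewrite -(ler_pM2l h1).
  rewrite -normrM mulrBr [h^-1 *: _]/(h^-1 * _) mulVKf //.
  apply: (le_trans fh).
  rewrite -(real_normK (num_real h)) expr2 mulrCA.
  rewrite ler_wpM2l //.
  apply: (@le_trans _ _ ((`|C| + 1) * `|h|)).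
    by rewrite ler_wpM2r // (le_trans (ler_norm C)) // lerDl.
  by rewrite mulrC -ler_pdivlMr // ltr_wpDl.
apply: DeriveDef; first by apply/cvg_ex; exists l.
exact/cvg_lim.
Unshelve. all: by end_near. Qed.

(** The telescoping series is dominated by a geometric one, hence converges absolutely. *)
Lemma cvgn_geometric_step (u : R^nat) (C : R) :
  (forall n, `|u n.+1 - u n| <= C * 2^-1 ^+ n) -> cvgn u.
Proof.
move=> uC.
have -> : u = (fun n => u 0%N + series (telescope u) n).
  by apply/funext => n; rewrite -eq_sum_telescope.
apply: is_cvgD; first exact: is_cvg_cst.
apply: normed_cvg.
apply: (@series_le_cvg _ _ (geometric C 2^-1)) => //= [n|].
- by apply: le_trans (uC n); rewrite normr_ge0.
- by apply: is_cvg_geometric_series; rewrite gtr0_norm ?invr_gt0 // invf_lt1 // ltr1n.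
Qed.

End Calculus.

Section Picard.
Variable R : realType.
Implicit Types (f : R -> R) (s t : R).

Lemma mean_value_dist (a : R) f (df : R -> R) s t :
    (forall c : R, a < c -> is_derive c 1 f (df c)) -> a < s -> a < t ->
  exists c, [/\ a < c, Num.min s t <= c <= Num.max s t
                & f t - f s = df c * (t - s)].
Proof.
move=> fP.
wlog st : s t / s <= t => [H|] as_ at_.
  have /orP[st|ts] := le_total s t; first exact: H.
  have [c [ac mc e]] := H t s ts at_ as_.
  exists c; split => //; first by rewrite minC maxC.
  by rewrite -opprB e -mulrN opprB.
have [c /andP[sc ct] e] := @mean_value R f df s t st
  (fun c cP => fP c (lt_le_trans as_ (andP cP).1)).
exists c; split => //; first exact: lt_le_trans sc.
by rewrite (min_idPl st) (max_idPr st) sc.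
Qed.

(** The derivatives of [h - f] and [h + f] are nonnegative, and the mean value theorem for each
    gives one sign. This replaces integration of the bound in the estimates on iterates. *)
Lemma mean_value_le f (df : R -> R) (h dh : R -> R) t : 0 <= t ->
    (forall c : R, 0 <= c -> is_derive c 1 f (df c)) ->
    (forall c : R, 0 <= c -> is_derive c 1 h (dh c)) ->
    (forall c : R, 0 <= c -> `|df c| <= dh c) -> `|f 0| <= h 0 ->
  `|f t| <= h t.
Proof.
move=> t0 fP hP dfh fh0.
have [|c /andP[c0 _]] := @mean_value R (h - f) (dh - df) 0 t t0.
  by move=> c /andP[c0 _]; apply: is_deriveB; [exact: hP|exact: fP].
have [|b /andP[b0 _]] := @mean_value R (h + f) (dh + df) 0 t t0.
  by move=> b /andP[b0 _]; apply: is_deriveD; [exact: hP|exact: fP].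
rewrite !fctE !subr0 => e1 e2.
have := dfh _ c0; have := dfh _ b0; move: fh0; rewrite !ler_norml.
move=> /andP[f1 f2] /andP[b1 b2] /andP[c1 c2].
have : 0 <= (dh b + df b) * t by rewrite mulr_ge0 //; lra.
have : 0 <= (dh c - df c) * t by rewrite mulr_ge0 //; lra.
lra.
Qed.

Lemma lipschitz_continuous f (L : R) :
  (forall s t, `|f s - f t| <= L * `|s - t|) -> continuous f.
Proof.
move=> fL t; apply/cvgrPdist_le => /= e e0; near=> s.
apply: le_trans (fL t s) _.
apply: (@le_trans _ _ ((`|L| + 1) * `|t - s|)).
  by rewrite ler_wpM2r // (le_trans (ler_norm L)) // lerDl.
rewrite mulrC -ler_pdivlMr ?ltr_wpDl //.
near: s; apply: cvgr_dist_le; first exact: cvg_id.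
by rewrite divr_gt0 // ltr_wpDl.
Unshelve. all: by end_near. Qed.

Lemma clamp0_lipschitz s t : `|Num.max s 0 - Num.max t 0| <= `|s - t|.
Proof.
wlog st : s t / t <= s => [H|].
  by have /orP[/H//|/H] := le_total t s; rewrite distrC [leRHS]distrC.
rewrite [leRHS]ger0_norm ?subr_ge0 // ler_norml.
by case: (leP s 0); case: (leP t 0) => ? ?; apply/andP; split; lra.
Qed.

(** Clamping is 1-Lipschitz and fixes [t], so freezing time at 0 never takes an intermediate point
    farther from [t] than [s] is. *)
Lemma clamp0_dist s t c : 0 <= t -> Num.min t s <= c <= Num.max t s ->
  `|Num.max c 0 - t| <= `|s - t|.
Proof.
move=> t0; rewrite -[X in _ - X](max_idPl t0) => /andP[tc ct].
apply: le_trans (clamp0_lipschitz _ _) _.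
have /orP[st|st] := le_total s t.
  rewrite (min_idPr st) (max_idPl st) in tc ct.
  by rewrite !ler0_norm; lra.
rewrite (min_idPl st) (max_idPr st) in tc ct.
by rewrite !ger0_norm; lra.
Qed.

Variables (I : finType) (F : (I -> R) -> I -> R) (K M : R).
Hypothesis K_gt0 : 0 < K.
Hypothesis F_lipschitz : forall x y (d : R) i, (forall j, `|x j - y j| <= d) ->
  `|F x i - F y i| <= K * d.
Hypothesis F_bounded : forall x i, `|F x i| <= M.
Variable x0 : I -> R.

(* Integration starts at -1 so that iterates are differentiable on both sides of 0; for
   negative times the field is frozen at its value at time 0. *)
Definition picard_admissible (x : R -> I -> R) : Prop :=
  x 0 = x0 /\ forall s t i, -1 < s -> -1 < t -> `|x s i - x t i| <= M * `|s - t|.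

(** The new iterate is [x0] plus the primitive of [F] along [x]. The integrand is [K * M]-Lipschitz
    in time, hence continuous, and the bound [M] on [F] makes the result [M]-Lipschitz again. *)
Lemma picard_step (x : R -> I -> R) : picard_admissible x ->
  exists y : R -> I -> R, picard_admissible y /\
    forall t i, -1 < t -> is_derive t 1 (y^~ i) (F (x (Num.max t 0)) i).
Proof.
move=> [x00 xM].
have max_gt (s : R) : -1 < Num.max s 0 by rewrite lt_max ltrN10 orbT.
have cf i : continuous (fun s => F (x (Num.max s 0)) i).
  apply: (@lipschitz_continuous _ (K * M)) => s t; rewrite -mulrA.
  apply: F_lipschitz => j; apply: le_trans (xM _ _ _ _ _) _ => //.
  have M0 : 0 <= M by apply: le_trans (F_bounded x0 i).
  by rewrite ler_wpM2l // clamp0_lipschitz.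
have /choice[P PP] : forall i, exists P : R -> R, P 0 = 0 /\
    forall t, -1 < t -> is_derive t 1 P (F (x (Num.max t 0)) i).
  by move=> i; have [P P0 dP] := continuous_primitive (@cf i); exists P.
have dP t i : -1 < t ->
    is_derive t 1 (fun t => x0 i + P i t) (F (x (Num.max t 0)) i).
  move=> /((PP i).2 t) dPi; rewrite -[X in is_derive _ _ _ X]add0r.
  exact: is_deriveD (is_derive_cst (x0 i) t 1) dPi.
exists (fun t i => x0 i + P i t); split => //; split.
  by apply/funext => i; rewrite (PP i).1 addr0.
move=> s t i s1 t1; rewrite distrC [in leRHS]distrC.
have [c [_ _ ->]] := mean_value_dist (fun c => @dP c i) s1 t1.
by rewrite normrM ler_wpM2r.
Qed.

Lemma picard_sequence : exists X : nat -> R -> I -> R,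
  [/\ X 0%N = fun=> x0, forall n, picard_admissible (X n)
    & forall n t i, -1 < t ->
        is_derive t 1 (X n.+1 ^~ i) (F (X n (Num.max t 0)) i)].
Proof.
(* The step must be total for [choice], so nothing is required of it at inadmissible functions. *)
have /choice[S SP] : forall x : R -> I -> R, exists y : R -> I -> R,
    picard_admissible x -> picard_admissible y /\
    forall t i, -1 < t -> is_derive t 1 (y^~ i) (F (x (Num.max t 0)) i).
  move=> x; have [/picard_step[y yP]|xN] := pselect (picard_admissible x).
    by exists y.
  by exists x.
have X_adm n : picard_admissible (iter n S (fun=> x0)).
  elim: n => [|n IHn] /=; last by have [] := SP _ IHn.
  split => // s t i _ _; rewrite subrr normr0 mulr_ge0 //.
  by apply: le_trans (F_bounded x0 i).
exists (fun n => iter n S (fun=> x0)); split => // n t i t1.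
by have [_] := SP _ (X_adm n); apply.
Qed.

(* The quadratic estimate |x s - x t - (s - t) F (x t)| <= K M (s - t)^2 holds for the
   iterates and survives pointwise limits, so uniform convergence is not needed. *)
Theorem picard_lindelof : exists x : R -> I -> R,
  x 0 = x0 /\ forall (t : R) i, 0 <= t -> is_derive t 1 (x^~ i) (F (x t) i).
Proof.
have [X [X0 X_adm dX]] := picard_sequence.
have X_0 n : X n 0 = x0 by have [] := X_adm n.
have gt_N1 t : 0 <= t -> -1 < t by apply: lt_le_trans; rewrite ltrN10.
have M0 (i : I) : 0 <= M by apply: le_trans (F_bounded x0 i).
(* The weight [expR (2 K t)] makes the Picard map a contraction of ratio 1/2 globally. *)
pose B (n : nat) t := M / (2 * K) * 2^-1 ^+ n * expR (2 * K * t).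
have dB n t : is_derive t 1 (B n) (2 * K * B n t).
  rewrite /B; apply: is_derive_eq; rewrite /GRing.scale /= !mulr1 ?mulr0 ?addr0 ?add0r.
  by ring.
(* The derivative of [B 0] is [M * expR (2 * K * t)], which is at least [M], and [K * B n] equals
   [2 * K * B n.+1], the derivative of [B n.+1]. *)
have XB n t i : 0 <= t -> `|X n.+1 t i - X n t i| <= B n t.
  elim: n t i => [|n IHn] t i t0.
    pose dh c := 2 * K * B 0%N c.
    pose f c := X 1%N c i - x0 i.
    pose df (c : R) := F x0 i.
    rewrite X0; apply: (@mean_value_le f df (B 0%N) dh) => //.
    - move=> c /gt_N1/(dX 0%N _ i) dXc; rewrite X0 in dXc.
      rewrite /df -[F _ _]subr0.
      exact: is_deriveB dXc (is_derive_cst (x0 i) c 1).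
    - move=> c c0; apply: le_trans (F_bounded _ _) _; rewrite /dh /B expr0 mulr1.
      rewrite mulrA mulrCA mulfV ?mulr1 ?mulf_neq0 ?gt_eqF //.
      by rewrite ler_peMr // ?(M0 i) // -expR0 ler_expR !mulr_ge0 // ltW.
    - rewrite /f X_0 subrr normr0 /B !mulr_ge0 ?expR_ge0 ?(M0 i) //.
      by rewrite invr_ge0 mulr_ge0 // ltW.
  pose f c := X n.+2 c i - X n.+1 c i.
  pose df c := F (X n.+1 (Num.max c 0)) i - F (X n (Num.max c 0)) i.
  apply: (@mean_value_le f df (B n.+1) (fun c => 2 * K * B n.+1 c)) => //.
  - move=> c /gt_N1 c1; have := dX n.+1 c i c1; have := dX n c i c1.
    by move=> ? ?; apply: is_deriveB.
  - move=> c c0; rewrite /df (max_idPl c0).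
    apply: le_trans (F_lipschitz i (IHn c ^~ c0)) _.
    rewrite /B exprS le_eqVlt; apply/orP; left; apply/eqP.
    by field; rewrite gt_eqF.
  - rewrite /f !X_0 subrr normr0 /B !mulr_ge0 ?expR_ge0 ?exprn_ge0 ?(M0 i) //.
    by rewrite invr_ge0 mulr_ge0 // ltW.
(* [XB] covers only nonnegative times. Before 0 the field is frozen at [F x0], so all iterates from
   the first on are the same affine function. *)
have Xneg n t i : -1 < t -> t <= 0 -> X n.+1 t i = x0 i + t * F x0 i.
  move=> t1 t0.
  have [c [_ /andP[_]]] := mean_value_dist (fun c => @dX n c i) (gt_N1 _ (lexx 0)) t1.
  rewrite (max_idPl t0) => c0; rewrite (max_idPr c0) !X_0 subr0 mulrC => <-.
  by rewrite addrC subrK.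
have X_cvg t i : -1 < t -> cvgn (fun n => X n t i).
  move=> t1; have /orP[t0|t0] := le_total 0 t.
    pose C := M / (2 * K) * expR (2 * K * t).
    apply: (@cvgn_geometric_step R _ C) => n.
    by rewrite /C mulrAC; exact: XB.
  apply: (@cvgn_geometric_step R _ `|X 1%N t i - X 0%N t i|) => -[|n].
    by rewrite expr0 mulr1.
  by rewrite !Xneg // subrr normr0 mulr_ge0 // exprn_ge0 // invr_ge0.
pose x t i := limn (fun n => X n t i).
have x_0 : x 0 = x0.
  apply/funext => i; rewrite /x.
  under eq_fun do rewrite X_0.
  exact: lim_cst.
exists x; split => // t i t0.
have t1 := gt_N1 _ t0.
(* The radius [1 + t] confines [s] to times after -1, where the iterates are differentiable. *)
apply: (@is_derive_quadratic R _ t _ (K * M) (1 + t)); first by rewrite ltr_wpDr.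
move=> s; rewrite opprD addrC subrK => s1.
have FX : F (X n t) i @[n --> \oo] --> F (x t) i.
  apply/cvgrPdist_le => /= e e0; near=> n.
  rewrite -[e](@mulfVK _ K) ?gt_eqF // mulrC.
  apply: F_lipschitz.
  near: n; apply: filter_forall => j.
  have /cvgrPdist_le := X_cvg t j t1; apply.
  by rewrite divr_gt0.
have cvgS (r : R) : -1 < r -> X n.+1 r i @[n --> \oo] --> x r i.
  by move=> r1; rewrite (cvg_shiftS (fun n => X n r i)); exact: X_cvg.
apply: (@closed_cvg _ _ \oo _ (fun n => `|X n.+1 s i - X n.+1 t i - (s - t) * F (X n t) i|)
         (fun z => z <= K * M * (s - t) ^+ 2) (@closed_le _ _)).
(* At the mean value point, clamped at 0, the iterate is within [M * |s - t|] of its value at [t];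
   the Lipschitz bound on [F] then gives the factor [K]. *)
- apply: nearW => n.
  have [c [c1 cst ->]] := mean_value_dist (fun c => @dX n c i) t1 s1.
  rewrite mulrC -mulrBr normrM -(real_normK (num_real (s - t))) expr2 mulrCA.
  rewrite ler_wpM2l // -mulrA; apply: F_lipschitz => j.
  have [_ XM] := X_adm n.
  apply: le_trans (XM _ _ _ _ _) _ => //; first by rewrite lt_max ltrN10 orbT.
  by rewrite ler_wpM2l ?(M0 i) // clamp0_dist.
- apply: cvg_norm; apply: cvgB; first by apply: cvgB; exact: cvgS.
  by apply: cvgMr; exact: FX.
Unshelve. all: by end_near. Qed.
End Picard.

(** * Locally Lipschitz fields and their cutoff *)

Section LocallyLipschitz.
Variables (R : realType) (I : finType).
Implicit Types (f g : (I -> R) -> R) (x y : I -> R).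

(** Lipschitz for the sup distance on every cube: unlike global Lipschitz continuity, this is stable
    under products and so covers polynomial fields. *)
Definition locally_lipschitz f : Prop := forall B : R, 0 <= B ->
  exists L : R, forall x y (d : R),
    (forall j, `|x j| <= B) -> (forall j, `|y j| <= B) ->
    (forall j, `|x j - y j| <= d) -> `|f x - f y| <= L * d.

Lemma locally_lipschitz_bounded f (B : R) : locally_lipschitz f -> 0 <= B ->
  exists M : R, forall x, (forall j, `|x j| <= B) -> `|f x| <= M.
Proof.
move=> fL B0; have [L LP] := fL B B0.
exists (`|f (fun=> 0)| + L * B) => x xB.
rewrite -[f x](subrK (f (fun=> 0))) addrC.
apply: le_trans (ler_normD _ _) _; rewrite lerD2l; apply: LP => // j.
  by rewrite normr0.
by rewrite subr0.
Qed.

Lemma locally_lipschitz_cst (c : R) : locally_lipschitz (fun=> c).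
Proof. by move=> B _; exists 0 => x y d _ _ _; rewrite subrr normr0 mul0r. Qed.

Lemma locally_lipschitz_coord i : locally_lipschitz (fun x => x i).
Proof. by move=> B _; exists 1 => x y d _ _ /(_ i); rewrite mul1r. Qed.

Lemma locally_lipschitzD f g : locally_lipschitz f -> locally_lipschitz g ->
  locally_lipschitz (fun x => f x + g x).
Proof.
move=> fL gL B B0; have [L LP] := fL B B0; have [L' LP'] := gL B B0.
exists (L + L') => x y d xB yB xy.
by rewrite opprD addrACA mulrDl (le_trans (ler_normD _ _)) // lerD ?LP ?LP'.
Qed.

Lemma locally_lipschitzM f g : locally_lipschitz f -> locally_lipschitz g ->
  locally_lipschitz (fun x => f x * g x).
Proof.
move=> fL gL B B0; have [L LP] := fL B B0; have [L' LP'] := gL B B0.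
have [M MP] := locally_lipschitz_bounded fL B0.
have [M' MP'] := locally_lipschitz_bounded gL B0.
exists (M * L' + M' * L) => x y d xB yB xy.
have -> : f x * g x - f y * g y = f x * (g x - g y) + g y * (f x - f y) by ring.
apply: le_trans (ler_normD _ _) _; rewrite mulrDl -!mulrA !normrM.
by apply: lerD; apply: ler_pM => //; [exact: MP|exact: LP'|exact: MP'|exact: LP].
Qed.

Lemma locally_lipschitzN f : locally_lipschitz f ->
  locally_lipschitz (fun x => - f x).
Proof.
move=> fL; have := locally_lipschitzM (locally_lipschitz_cst (-1)) fL.
by congr locally_lipschitz; apply/funext => x; rewrite mulN1r.
Qed.

Lemma locally_lipschitz_sum (T : finType) (f : T -> (I -> R) -> R) :
  (forall k, locally_lipschitz (f k)) ->
  locally_lipschitz (fun x => \sum_k f k x).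
Proof.
move=> fL; elim: (index_enum T) => [|k s IHs].
  under eq_fun do rewrite big_nil; exact: locally_lipschitz_cst.
by under eq_fun do rewrite big_cons; exact: locally_lipschitzD.
Qed.

End LocallyLipschitz.

(** The factor [chi] is piecewise linear in the sum of the absolute values of the coordinates: 1 up
    to [B], 0 from [B + 1] on. [phi] is its value along the solution. *)
Lemma cutoff_solution (R : realType) (I : finType) (F : (I -> R) -> I -> R)
    (B : R) (x0 : I -> R) :
    (forall i, locally_lipschitz (F^~ i)) -> 0 <= B ->
  exists (x : R -> I -> R) (phi : R -> R),
    [/\ x 0 = x0,
        forall (t : R) i, 0 <= t -> is_derive t 1 (x^~ i) (phi t * F (x t) i)
      & forall t, \sum_i `|x t i| <= B -> phi t = 1].
Proof.
move=> FL B0; have B1 : 0 <= B + 1 by rewrite addr_ge0.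
pose N (z : I -> R) := \sum_i `|z i|.
have N_ge (z : I -> R) i : `|z i| <= N z.
  by rewrite /N (bigD1 i) //= lerDl sumr_ge0.
have N_lip (y z : I -> R) (d : R) : (forall j, `|y j - z j| <= d) ->
    `|N y - N z| <= #|I|%:R * d.
  move=> yz; rewrite /N -sumrB; apply: le_trans (ler_norm_sum _ _ _) _.
  rewrite mulr_natl -sumr_const; apply: ler_sum => i _.
  by apply: le_trans (ler_dist_dist _ _) _.
pose chi z := Num.max 0 (Num.min 1 (B + 1 - N z)).
have chi_out z : B + 1 <= N z -> chi z = 0.
  by rewrite /chi => Nz; case: (leP 1) => ?; case: (leP 0) => ?; lra.
have chi_in z : N z <= B -> chi z = 1.
  by rewrite /chi => Nz; case: (leP 1) => ?; case: (leP 0) => ?; lra.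
have chi_ge0 z : 0 <= chi z by rewrite le_max lexx.
have chi_le1 z : chi z <= 1 by rewrite ge_max ler01 ge_min lexx.
have chi_lip y z : `|chi y - chi z| <= `|N y - N z|.
  wlog yz : y z / N y <= N z => [H|].
    by have /orP[/H//|/H] := le_total (N y) (N z); rewrite distrC [leRHS]distrC.
  rewrite [leRHS]ler0_norm ?subr_le0 // ler_norml /chi.
  by case: (leP 1) => ?; case: (leP 0) => ?; case: (leP 1) => ?;
     case: (leP 0) => ?; apply/andP; split; lra.
have /choice[L LP] := fun i => FL i _ B1.
have /choice[M MP] := fun i => locally_lipschitz_bounded (FL i) B1.
pose sL := \sum_i `|L i|; pose sM := \sum_i `|M i|.
have sL_ge i : L i <= sL.
  by rewrite (le_trans (ler_norm _)) // /sL (bigD1 i) //= lerDl sumr_ge0.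
have sM_ge i : M i <= sM.
  by rewrite (le_trans (ler_norm _)) // /sM (bigD1 i) //= lerDl sumr_ge0.
have sL0 : 0 <= sL by exact: sumr_ge0.
have sM0 : 0 <= sM by exact: sumr_ge0.
have F_le z i : N z <= B + 1 -> `|F z i| <= sM.
  move=> Nz; apply: le_trans (sM_ge i); apply: MP => j.
  exact: le_trans (N_ge z j) Nz.
(* The first term is the Lipschitz constant of [chi] times the bound on [F], the second the
   Lipschitz constant of [F] on the support; the 1 ensures positivity. *)
pose K := #|I|%:R * sM + sL + 1.
have K0 : 0 < K by rewrite ltr_wpDl // addr_ge0 // mulr_ge0.
have [x [x_0 dx]] : exists x : R -> I -> R, x 0 = x0 /\
    forall (t : R) i, 0 <= t -> is_derive t 1 (x^~ i) (chi (x t) * F (x t) i).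
  apply: (@picard_lindelof R I (fun z i => chi z * F z i) K sM) => //.
  (* With [y] the inner point, the increment of [chi] multiplies [F y], which is bounded by [sM]; if
     [z] lies outside the support, [chi z = 0] removes the other term. *)
  - move=> y z d i; wlog yz : y z / N y <= N z => [H|] yzd.
      have /orP[yz|zy] := le_total (N y) (N z); first exact: H.
      by rewrite distrC; apply: H => // j; rewrite distrC.
    have d0 : 0 <= d by apply: le_trans (yzd i).
    have [/ltW Ny|Ny] := ltP (B + 1) (N y).
      rewrite !chi_out //; last exact: le_trans Ny yz.
      by rewrite !mul0r subrr normr0 mulr_ge0 // ltW.
    have -> : chi y * F y i - chi z * F z i
        = (chi y - chi z) * F y i + chi z * (F y i - F z i) by ring.
    apply: le_trans (ler_normD _ _) _.
    have -> : K * d = #|I|%:R * d * sM + (sL + 1) * d by rewrite /K; ring.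
    rewrite !normrM; apply: lerD.
      apply: ler_pM => //; last exact: F_le.
      by apply: le_trans (chi_lip _ _) _; exact: N_lip.
    have [/ltW Nz|Nz] := ltP (B + 1) (N z).
      by rewrite chi_out // normr0 mul0r mulr_ge0 // addr_ge0.
    have FL' : `|F y i - F z i| <= (sL + 1) * d.
      apply: (@le_trans _ _ (L i * d)).
        by apply: LP => // j; [apply: le_trans Ny|apply: le_trans Nz].
      by rewrite ler_wpM2r // (le_trans (sL_ge i)) // lerDl.
    by rewrite -[leRHS]mul1r ler_pM // ger0_norm.
  - move=> z i; have [/ltW Nz|Nz] := ltP (B + 1) (N z).
      by rewrite chi_out // mul0r normr0.
    by rewrite normrM -[leRHS]mul1r ler_pM // ?F_le // ger0_norm.
by exists x, (fun t => chi (x t)); split => // t /chi_in.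
Qed.

(** * Vectors and matrix-valued derivatives *)

Section VectorAlgebra.
Variable R : realType.
Implicit Types a b c v w : 'cV[R]_3.

Definition dot a b : R := (a^T *m b) 0 0.

Lemma dotE a b : dot a b = a 0 0 * b 0 0 + a 1 0 * b 1 0 + a 2 0 * b 2 0.
Proof.
have e1 : lift ord0 ord0 = 1 :> 'I_3 by apply/val_inj.
have e2 : lift ord0 (lift ord0 ord0) = 2 :> 'I_3 by apply/val_inj.
by rewrite /dot mxE !big_ord_recl big_ord0 !mxE !e1 !e2 addr0 addrA.
Qed.

Lemma crossE0 a b : cross a b 0 0 = a 1 0 * b 2 0 - a 2 0 * b 1 0.
Proof. by rewrite mxE. Qed.

Lemma crossE1 a b : cross a b 1 0 = a 2 0 * b 0 0 - a 0 0 * b 2 0.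
Proof. by rewrite mxE. Qed.

Lemma crossE2 a b : cross a b 2 0 = a 0 0 * b 1 0 - a 1 0 * b 0 0.
Proof. by rewrite mxE. Qed.

Definition crossE := (crossE0, crossE1, crossE2).

Lemma col3P a b : a 0 0 = b 0 0 -> a 1 0 = b 1 0 -> a 2 0 = b 2 0 -> a = b.
Proof.
move=> e0 e1 e2; apply/colP => -[[|[|[|//]]] i3].
- by rewrite (_ : Ordinal i3 = 0) //; apply/val_inj.
- by rewrite (_ : Ordinal i3 = 1) //; apply/val_inj.
- by rewrite (_ : Ordinal i3 = 2) //; apply/val_inj.
Qed.

Lemma dotC a b : dot a b = dot b a.
Proof. by rewrite !dotE; ring. Qed.

Lemma dotDl a b c : dot (a + b) c = dot a c + dot b c.
Proof. by rewrite !dotE !mxE; ring. Qed.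

Lemma dotDr a b c : dot a (b + c) = dot a b + dot a c.
Proof. by rewrite !dotE !mxE; ring. Qed.

Lemma dotZl k a b : dot (k *: a) b = k * dot a b.
Proof. by rewrite !dotE !mxE; ring. Qed.

Lemma dotZr k a b : dot a (k *: b) = k * dot a b.
Proof. by rewrite !dotE !mxE; ring. Qed.

Lemma dotNr a b : dot a (- b) = - dot a b.
Proof. by rewrite -scaleN1r dotZr mulN1r. Qed.

Lemma dot_ge0 a : 0 <= dot a a.
Proof. by rewrite dotE -!expr2 !addr_ge0 // sqr_ge0. Qed.

Lemma dot_delta i v : dot (delta_mx i 0) v = v i 0.
Proof. by rewrite /dot trmx_delta -rowE !mxE. Qed.

Lemma dot_mulmx (A : 'M[R]_3) a b : dot a (A *m b) = dot (A^T *m a) b.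
Proof. by rewrite /dot trmx_mul trmxK mulmxA. Qed.

(** A quarter turn of the horizontal part of [v] works unless that part vanishes; then any
    horizontal vector does. *)
Lemma orthogonal_vector v : exists2 u : 'cV[R]_3, u != 0 & dot v u = 0.
Proof.
pose u : 'cV[R]_3 := \col_(i < 3) [:: v 1 0; - v 0 0; 0]`_i.
have [u0|u_neq0] := eqVneq u 0; last first.
  by exists u => //; rewrite dotE !mxE /=; ring.
exists (delta_mx 0 0).
  apply/eqP => /matrixP/(_ 0 0); rewrite !mxE /= => /eqP.
  by rewrite oner_eq0.
have := congr1 (fun z : 'cV[R]_3 => z 1 0) u0.
rewrite /u !mxE /= => /eqP; rewrite oppr_eq0 => /eqP v0.
by rewrite dotC dot_delta.
Qed.

(** The determinant as triple product of the rows. For an attitude these are the basis vectors of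
    space seen from the body, whose motion is known. *)
Lemma det3_dot (A : 'M[R]_3) :
  \det A = dot (A^T *m delta_mx 0 0)
             (cross (A^T *m delta_mx 1 0) (A^T *m delta_mx 2 0)).
Proof.
(* Indexing by [nat] lets differently written ordinals reduce to the same entry before [ring]. *)
have [a AE] : exists a : nat -> nat -> R, forall i j, A i j = a i j.
  by exists (fun k l => A (inord k) (inord l)) => i j; rewrite !inord_val.
rewrite -!colE dotE !crossE !mxE.
rewrite (expand_det_row _ 0) !big_ord_recl big_ord0 /cofactor.
rewrite !(expand_det_row _ 0) !big_ord_recl !big_ord0 /cofactor !det_mx11 !mxE.
by rewrite !AE /= /bump /=; ring.
Qed.

End VectorAlgebra.

Section MatrixDerivative.
Variable R : realType.
Implicit Types s t : R.

(** Entrywise, so that product rules reduce to the scalar ones; [is_mderiveP] links it to the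
    derivative in the normed space. *)
Definition is_mderive p q (A : R -> 'M[R]_(p, q)) t (dA : 'M[R]_(p, q)) : Prop :=
  forall i j, is_derive t 1 (fun s => A s i j) (dA i j).

Lemma is_mderiveP p q (A : R -> 'M[R]_(p, q)) t dA :
  is_mderive A t dA <-> derivable A t 1 /\ derive1 A t = dA.
Proof.
split=> [AP|[dAt <-] i j].
  have dAt : derivable A t 1.
    by apply/derivable_mxP => i j; exact: (@ex_derive _ _ _ _ _ _ _ (AP i j)).
  split => //; rewrite derive1E derive_mx //; apply/matrixP => i j.
  by rewrite mxE; exact: (@derive_val _ _ _ _ _ _ _ (AP i j)).
rewrite derive1E derive_mx // mxE.
by apply: DeriveDef => //; exact: (derivable_mxP A t 1).1.
Qed.

Lemma is_mderive_cst p q (A : 'M[R]_(p, q)) t : is_mderive (fun=> A) t 0.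
Proof. by move=> i j; rewrite mxE; exact: is_derive_cst. Qed.

Lemma is_mderiveT p q (A : R -> 'M[R]_(p, q)) t dA :
  is_mderive A t dA -> is_mderive (fun s => (A s)^T) t dA^T.
Proof. by move=> AP i j; rewrite mxE; under eq_fun do rewrite mxE. Qed.

Lemma is_mderiveM p q r (A : R -> 'M[R]_(p, q)) (B : R -> 'M[R]_(q, r)) t dA dB :
    is_mderive A t dA -> is_mderive B t dB ->
  is_mderive (fun s => A s *m B s) t (dA *m B t + A t *m dB).
Proof.
move=> AP BP i j; rewrite !mxE -big_split /=.
under eq_fun do rewrite mxE.
have -> : (fun s => \sum_k A s i k * B s k j)
    = \sum_k ((fun s => A s i k) * (fun s => B s k j)).
  by apply/funext => s; rewrite fct_sumE.
apply: is_derive_sum => k.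
have dAk := AP i k; have dBk := BP k j.
by apply: is_derive_eq; rewrite /GRing.scale /= addrC; congr (_ + _); rewrite mulrC.
Qed.

Lemma is_derive_dot (a b : R -> 'cV[R]_3) t da db :
    is_mderive a t da -> is_mderive b t db ->
  is_derive t 1 (fun s => dot (a s) (b s)) (dot da (b t) + dot (a t) db).
Proof.
move=> aP bP; have := is_mderiveM (is_mderiveT aP) bP => /(_ 0 0).
by rewrite mxE.
Qed.

Lemma is_mderive_cross (a b : R -> 'cV[R]_3) t da db :
    is_mderive a t da -> is_mderive b t db ->
  is_mderive (fun s => cross (a s) (b s)) t (cross da (b t) + cross (a t) db).
Proof.
move=> aP bP i j.
have main k l : is_derive t 1 (fun s => a s k 0 * b s l 0 - a s l 0 * b s k 0)
   (da k 0 * b t l 0 - da l 0 * b t k 0 + (a t k 0 * db l 0 - a t l 0 * db k 0)).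
  have ak := aP k 0; have al := aP l 0; have bk := bP k 0; have bl := bP l 0.
  have := is_deriveB (is_deriveM ak bl) (is_deriveM al bk).
  by move=> h; apply: (is_derive_eq h); rewrite /GRing.scale /=; ring.
by case: i => -[|[|[|//]]] ?; rewrite !mxE /=; under eq_fun do rewrite mxE /=; apply: main.
Qed.

Lemma derive0_constant (f : R -> R) :
    (forall t : R, 0 <= t -> is_derive t 1 f 0) ->
  forall t, 0 <= t -> f t = f 0.
Proof.
move=> fP t t0; apply/eqP; rewrite -subr_eq0; apply/eqP.
have [|c _ ->] := @mean_value R f (fun=> 0) 0 t t0; last by rewrite mul0r.
by move=> c /andP[/fP].
Qed.

End MatrixDerivative.

(** * The pendulum *)

Section Inertia.
Variables (R : realType) (J : 'M[R]_3).
Hypothesis hJ : sym_posdef J.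
Implicit Types u v w : 'cV[R]_3.

Lemma dot_inertiaC u v : dot u (J *m v) = dot (J *m u) v.
Proof. by rewrite dot_mulmx hJ.1. Qed.

Lemma kinetic_gt0 v : v != 0 -> 0 < dot v (J *m v).
Proof. by rewrite /dot mulmxA; exact: hJ.2. Qed.

Lemma kinetic_ge0 v : 0 <= dot v (J *m v).
Proof.
have [->|/kinetic_gt0/ltW//] := eqVneq v 0.
by rewrite mulmx0 /dot mulmx0 mxE.
Qed.

(** The quadratic form of [J] is nonnegative at [a *: u - b *: v], with [a = v.Jv] and
    [b = u.Jv]. *)
Lemma kinetic_cauchy_schwarz u v :
  dot u (J *m v) ^+ 2 <= dot u (J *m u) * dot v (J *m v).
Proof.
have [->|/kinetic_gt0 v0] := eqVneq v 0.
  by rewrite mulmx0 /dot !mulmx0 mxE expr0n mulr0.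
set a := dot v _ in v0 *; set b := dot u (J *m v).
have := kinetic_ge0 (a *: u - b *: v).
have uv : dot v (J *m u) = b by rewrite dotC -dot_inertiaC.
rewrite -scaleNr mulmxDr -!scalemxAr !(dotDl, dotDr, dotZl, dotZr) uv.
rewrite -/a -/b; set q := dot u (J *m u) => h.
have e : a * (a * q + - b * b) + (- b * (a * b) + - b * (- b * a))
    = a * (q * a - b ^+ 2) by ring.
by rewrite e pmulr_rge0 // subr_ge0 in h.
Qed.

Lemma inertia_unit : J \in unitmx.
Proof.
rewrite unitmxE unitfE; apply/negP => /eqP/eqP/det0P[v v0 vJ].
have := @kinetic_gt0 v^T; rewrite trmx_eq0 => /(_ v0).
by rewrite dot_inertiaC /dot trmx_mul trmxK hJ.1 vJ mul0mx mxE ltxx.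
Qed.

(** Cauchy-Schwarz for [J], applied to the coordinates of [v] as products [(J^-1 e_i).Jv] and to
    those of [Jv] as [e_i.Jv]; [D] dominates all the constants. *)
Lemma kinetic_bound : exists2 D : R, 0 < D & forall v i,
  v i 0 ^+ 2 <= D * dot v (J *m v) /\ (J *m v) i 0 ^+ 2 <= D * dot v (J *m v).
Proof.
pose c u := dot u (J *m u).
pose e i : 'cV[R]_3 := delta_mx i 0.
pose D := 1 + \sum_i (c (e i) + c (invmx J *m e i)).
have c0 u : 0 <= c u by exact: kinetic_ge0.
have D_ge i : c (e i) + c (invmx J *m e i) <= D.
  rewrite /D (bigD1 i) //= addrCA lerDl addr_ge0 // sumr_ge0 // => k _.
  by rewrite addr_ge0.
exists D; first by rewrite ltr_pwDl // sumr_ge0 // => i _; rewrite addr_ge0.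
move=> v i; split.
- have -> : v i 0 = dot (invmx J *m e i) (J *m v).
    by rewrite dot_inertiaC mulKVmx ?inertia_unit // dot_delta.
  apply: le_trans (kinetic_cauchy_schwarz _ _) _; rewrite ler_wpM2r ?kinetic_ge0 //.
  by apply: le_trans (D_ge i); rewrite lerDr.
- rewrite -dot_delta.
  apply: le_trans (kinetic_cauchy_schwarz _ _) _; rewrite ler_wpM2r ?kinetic_ge0 //.
  by apply: le_trans (D_ge i); rewrite lerDl.
Qed.

End Inertia.

(** * Conservation laws, up to a change of speed *)

Section ConservationLaws.
Variables (R : realType) (J : 'M[R]_3) (k : R) (rho : 'cV[R]_3).
Hypothesis hJ : sym_posdef J.

Definition torque (Q : 'M[R]_3) (w : 'cV[R]_3) : 'cV[R]_3 :=
  cross (J *m w) w + k *: cross rho (Q^T *m e3).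

Definition energy (Q : 'M[R]_3) (w : 'cV[R]_3) : R :=
  2^-1 * dot w (J *m w) - k * dot rho (Q^T *m e3).

(** The arbitrary factor [phi] covers both the cut-off system and genuine trajectories, where it is
    1. *)
Definition reparametrized_solution (Q : R -> 'M[R]_3) (w : R -> 'cV[R]_3)
    (phi : R -> R) : Prop :=
  forall t : R, 0 <= t -> exists dw : 'cV[R]_3,
    [/\ is_mderive Q t (phi t *: (Q t *m hat (w t))), is_mderive w t dw
      & J *m dw = phi t *: torque (Q t) (w t)].

Variables (Q : R -> 'M[R]_3) (w : R -> 'cV[R]_3) (phi : R -> R).
Hypothesis sol : reparametrized_solution Q w phi.

(** By skewness of [hat], the transpose of [Q *m hat w] applied to [e] is [- w x (Q^T e)]: a vector
    fixed in space appears to turn backwards. *)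
Lemma is_mderive_body_vector (e : 'cV[R]_3) (t : R) : 0 <= t ->
  is_mderive (fun s => (Q s)^T *m e) t (phi t *: cross ((Q t)^T *m e) (w t)).
Proof.
move=> /sol[dw [dQ _ _]].
have := is_mderiveM (is_mderiveT dQ) (is_mderive_cst e t).
congr is_mderive; rewrite mulmx0 addr0 linearZ /= trmx_mul hat_skew -scalemxAl.
rewrite !mulNmx -mulmxA hatE; congr (_ *: _).
by apply: col3P; rewrite mxE !crossE; ring.
Qed.

Lemma is_mderive_momentum (t : R) : 0 <= t ->
  is_mderive (fun s => J *m w s) t (phi t *: torque (Q t) (w t)).
Proof.
move=> /sol[dw [_ dw' <-]].
by have := is_mderiveM (is_mderive_cst J t) dw'; rewrite mul0mx add0r.
Qed.

(** For [Q Q^T], unlike [Q^T Q], skewness of [hat] alone makes the two terms of the derivative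
    cancel. *)
Lemma orthogonality_conserved (t : R) : 0 <= t ->
  Q t *m (Q t)^T = Q 0 *m (Q 0)^T.
Proof.
move=> t0; apply/matrixP => i j; move: t t0.
apply: (@derive0_constant R (fun t => (Q t *m (Q t)^T) i j)) => t /sol[dw [dQ _ _]].
have := is_mderiveM dQ (is_mderiveT dQ) i j.
congr is_derive; rewrite linearZ /= trmx_mul hat_skew -scalemxAl -scalemxAr.
by rewrite mulNmx mulmxN mulmxA scalerN subrr mxE.
Qed.

Lemma det_conserved (t : R) : 0 <= t -> \det (Q t) = \det (Q 0).
Proof.
move: t; apply: (@derive0_constant R (fun t => \det (Q t))) => t t0.
under eq_fun do rewrite det3_dot.
have := is_derive_dot (is_mderive_body_vector (delta_mx 0 0) t0)
  (is_mderive_cross (is_mderive_body_vector (delta_mx 1 0) t0)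
                    (is_mderive_body_vector (delta_mx 2 0) t0)).
congr is_derive.
move: (_ *m _) (_ *m _) (_ *m _) => a b c.
rewrite !dotE !(mxE, crossE) /=; ring.
Qed.

(** The gyroscopic term does no work, and the power [k w.(rho x gamma)] of gravity equals the change
    [k rho.(gamma x w)] of the potential term. *)
Lemma energy_conserved (t : R) : 0 <= t -> energy (Q t) (w t) = energy (Q 0) (w 0).
Proof.
move: t; apply: (@derive0_constant R (fun t => energy (Q t) (w t))) => t t0.
have [dw [_ dw' Jdw]] := sol t0.
have dT := is_derive_dot dw' (is_mderive_momentum t0).
have dV := is_derive_dot (is_mderive_cst rho t) (is_mderive_body_vector e3 t0).
have := is_deriveB (is_deriveZ 2^-1 dT) (is_deriveZ k dV).
congr is_derive.
rewrite dot_inertiaC // Jdw /torque /GRing.scale /=.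
move: (_ *m e3) (J *m w t) => a b.
by rewrite !dotE !(mxE, crossE) /=; field.
Qed.

(** The moment of gravity is orthogonal to [gamma], and [(Jw x w).gamma] cancels
    [Jw.(gamma x w)]. *)
Lemma vertical_momentum_conserved (t : R) : 0 <= t ->
  dot (J *m w t) ((Q t)^T *m e3) = dot (J *m w 0) ((Q 0)^T *m e3).
Proof.
move: t; apply: (@derive0_constant R (fun t => dot (J *m w t) ((Q t)^T *m e3))).
move=> t t0.
have := is_derive_dot (is_mderive_momentum t0) (is_mderive_body_vector e3 t0).
congr is_derive; rewrite /torque.
move: (_ *m e3) (J *m w t) => a b.
rewrite !dotE !(mxE, crossE) /=; ring.
Qed.

End ConservationLaws.

(** * Locally Lipschitz matrix-valued functions *)

Section LocallyLipschitzMatrices.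
Variables (R : realType) (I : finType).

Definition locally_lipschitz_mx p q (A : (I -> R) -> 'M[R]_(p, q)) : Prop :=
  forall i j, locally_lipschitz (fun z => A z i j).

Lemma locally_lipschitz_mxM p q r (A : (I -> R) -> 'M[R]_(p, q))
    (B : (I -> R) -> 'M[R]_(q, r)) :
    locally_lipschitz_mx A -> locally_lipschitz_mx B ->
  locally_lipschitz_mx (fun z => A z *m B z).
Proof.
move=> AL BL i j; under eq_fun do rewrite mxE.
by apply: locally_lipschitz_sum => k; apply: locally_lipschitzM.
Qed.

Lemma locally_lipschitz_mx_cst p q (A : 'M[R]_(p, q)) :
  locally_lipschitz_mx (fun=> A).
Proof. by move=> i j; exact: locally_lipschitz_cst. Qed.

Lemma locally_lipschitz_mxT p q (A : (I -> R) -> 'M[R]_(p, q)) :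
  locally_lipschitz_mx A -> locally_lipschitz_mx (fun z => (A z)^T).
Proof. by move=> AL i j; under eq_fun do rewrite mxE; exact: AL. Qed.

Lemma locally_lipschitz_mxD p q (A B : (I -> R) -> 'M[R]_(p, q)) :
    locally_lipschitz_mx A -> locally_lipschitz_mx B ->
  locally_lipschitz_mx (fun z => A z + B z).
Proof.
by move=> AL BL i j; under eq_fun do rewrite mxE; exact: locally_lipschitzD.
Qed.

Lemma locally_lipschitz_mxZ p q (k : R) (A : (I -> R) -> 'M[R]_(p, q)) :
  locally_lipschitz_mx A -> locally_lipschitz_mx (fun z => k *: A z).
Proof.
move=> AL i j; under eq_fun do rewrite mxE.
by apply: locally_lipschitzM; first exact: locally_lipschitz_cst.
Qed.

Lemma locally_lipschitz_cross (a b : (I -> R) -> 'cV[R]_3) :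
    locally_lipschitz_mx a -> locally_lipschitz_mx b ->
  locally_lipschitz_mx (fun z => cross (a z) (b z)).
Proof.
move=> aL bL i j.
have main k l :
    locally_lipschitz (fun z => a z k 0 * b z l 0 - a z l 0 * b z k 0).
  apply: locally_lipschitzD; last apply: locally_lipschitzN;
    by apply: locally_lipschitzM.
by case: i => -[|[|[|//]]] ?; under eq_fun do rewrite mxE /=; apply: main.
Qed.

Lemma locally_lipschitz_hat (a : (I -> R) -> 'cV[R]_3) :
  locally_lipschitz_mx a -> locally_lipschitz_mx (fun z => hat (a z)).
Proof.
move=> aL i j; under eq_fun do rewrite mxE.
exact: locally_lipschitz_cross (locally_lipschitz_mx_cst _) _ _.
Qed.

End LocallyLipschitzMatrices.

(** * Global existence of trajectories *)

Section Existence.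
Variables (R : realType) (J : 'M[R]_3) (m g : R) (rho : 'cV[R]_3).
Hypothesis hJ : sym_posdef J.

(** The nine entries of the attitude and the three of the velocity, to fit the coordinate form of
    [cutoff_solution]. *)
Let I : finType := (('I_3 * 'I_3) + 'I_3)%type.

Let attitude (z : I -> R) : 'M[R]_3 := \matrix_(i, j) z (inl (i, j)).
Let velocity (z : I -> R) : 'cV[R]_3 := \col_i z (inr i).

Let field (z : I -> R) (k : I) : R :=
  match k with
  | inl ij => (attitude z *m hat (velocity z)) ij.1 ij.2
  | inr i => (invmx J *m torque J (m * g) rho (attitude z) (velocity z)) i 0
  end.

Let field_lipschitz k : locally_lipschitz (field^~ k).
Proof.
have QL : locally_lipschitz_mx attitude.
  by move=> i j; under eq_fun do rewrite mxE; exact: locally_lipschitz_coord.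
have wL : locally_lipschitz_mx velocity.
  by move=> i j; under eq_fun do rewrite mxE; exact: locally_lipschitz_coord.
case: k => [[i j]|i] /=.
  exact: locally_lipschitz_mxM QL (locally_lipschitz_hat wL) i j.
suff torqueL : locally_lipschitz_mx
    (fun z => torque J (m * g) rho (attitude z) (velocity z)).
  exact: locally_lipschitz_mxM (locally_lipschitz_mx_cst I (invmx J)) torqueL i 0.
apply: locally_lipschitz_mxD.
  apply: locally_lipschitz_cross => //.
  exact: locally_lipschitz_mxM (locally_lipschitz_mx_cst _ _) wL.
apply: locally_lipschitz_mxZ; apply: locally_lipschitz_cross.
  exact: locally_lipschitz_mx_cst.
apply: locally_lipschitz_mxM; last exact: locally_lipschitz_mx_cst.
exact: locally_lipschitz_mxT.
Qed.

Let sqr_le_norm (a b : R) : a ^+ 2 <= b -> `|a| <= 1 + b.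
Proof.
move=> ab; have := sqr_ge0 (`|a| - 1); rewrite sqrrB expr1n real_normK ?num_real //.
have := normr_ge0 a; lra.
Qed.

Let orthogonal_entry (Q : 'M[R]_3) i j : Q *m Q^T = 1%:M -> `|Q i j| <= 1.
Proof.
move=> /matrixP/(_ i i); rewrite !mxE eqxx => QQ.
rewrite -(@ler_pXn2r _ 2) // ?nnegrE // expr1n real_normK ?num_real //.
rewrite -[leRHS]QQ (bigD1 j) //= !mxE -expr2 lerDl sumr_ge0 // => l _.
by rewrite mxE -expr2 sqr_ge0.
Qed.

Lemma trajectory_exists (x0 : state R) : TSO3 x0 ->
  exists2 x : R -> state R, trajectory J m g rho x & x 0 = x0.
Proof.
move=> [Q0 detQ0].
have [D D0 Dle] := kinetic_bound hJ.
pose k := m * g.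
(* Energy conservation gives [w.Jw = 2 E + 2 k rho.gamma], and the coordinates of [gamma] are at
   most 1 in absolute value. *)
pose T0 := 2 * `|energy J k rho x0.1 x0.2| + 2 * `|k| * \sum_i `|rho i 0|.
have T00 : 0 <= T0 by rewrite addr_ge0 ?mulr_ge0 ?sumr_ge0.
(* Bounds every coordinate: attitude entries by 1, and velocity entries by [sqr_le_norm], as their
   squares are at most [D * T0]. *)
pose b := 1 + D * T0.
have b1 : 1 <= b by rewrite lerDl mulr_ge0 // ltW.
pose z0 (i : I) := match i with inl ij => x0.1 ij.1 ij.2 | inr i => x0.2 i 0 end.
have b0 : 0 <= #|I|%:R * b by rewrite mulr_ge0 // (le_trans ler01).
have [z [phi [z_0 dz phi1]]] := cutoff_solution z0 field_lipschitz b0.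
pose Q t := attitude (z t); pose w t := velocity (z t).
have Q_0 : Q 0 = x0.1 by apply/matrixP => i j; rewrite mxE z_0.
have w_0 : w 0 = x0.2 by apply/colP => i; rewrite mxE z_0.
have dQ (t : R) : 0 <= t -> is_mderive Q t (phi t *: (Q t *m hat (w t))).
  move=> t0 i j; under eq_fun do rewrite mxE.
  rewrite mxE; exact: (dz t (inl (i, j)) t0).
pose dw t := phi t *: (invmx J *m torque J k rho (Q t) (w t)).
have dwP (t : R) : 0 <= t -> is_mderive w t (dw t).
  move=> t0 i j; under eq_fun do rewrite mxE.
  rewrite mxE (ord1 j); exact: (dz t (inr i) t0).
have sol : reparametrized_solution J k rho Q w phi.
  move=> t t0; exists (dw t); split; [exact: dQ|exact: dwP|].
  by rewrite -scalemxAr mulKVmx // inertia_unit.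
have QQ (t : R) : 0 <= t -> Q t *m (Q t)^T = 1%:M.
  by move=> t0; rewrite (orthogonality_conserved sol t0) Q_0 mulmx1C.
have Tle (t : R) : 0 <= t -> dot (w t) (J *m w t) <= T0.
  move=> t0; have := energy_conserved hJ sol t0.
  rewrite Q_0 w_0 {1}/energy => E.
  have rg : k * dot rho ((Q t)^T *m e3) <= `|k| * \sum_i `|rho i 0|.
    apply: le_trans (ler_norm _) _; rewrite normrM ler_wpM2l //.
    rewrite /dot mxE; apply: le_trans (ler_norm_sum _ _ _) _.
    apply: ler_sum => i _; rewrite normrM /e3 -colE !mxE.
    by rewrite ler_piMr //; have := orthogonal_entry 2 i (QQ t t0); rewrite mxE.
  have := ler_norm (energy J k rho x0.1 x0.2).
  rewrite /T0 -mulrA; lra.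
have z_le (t : R) i : 0 <= t -> `|z t i| <= b.
  move=> t0; case: i => [[i j]|i].
    apply: le_trans b1; have := orthogonal_entry i j (QQ t t0).
    by rewrite mxE.
  apply: sqr_le_norm; have [+ _] := Dle (w t) i.
  rewrite mxE => /le_trans; apply.
  by rewrite ler_wpM2l ?Tle // ltW.
(* The bounds hold whatever [phi] is, so there is no circularity: the orbit lies where the cutoff is
   1 and solves the true equation. *)
have phiE (t : R) : 0 <= t -> phi t = 1.
  move=> t0; apply: phi1; rewrite mulr_natl -sumr_const.
  by apply: ler_sum => i _; exact: z_le.
exists (fun t => (Q t, w t)); last by rewrite Q_0 w_0 -surjective_pairing.
move=> t t0 /=.
have [dQ1 dQ2] := (is_mderiveP _ _ _).1 (dQ t t0).
have [dw1 dw2] := (is_mderiveP _ _ _).1 (dwP t t0).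
split => //.
- by split; [apply: mulmx1C; exact: QQ|rewrite /= (det_conserved sol t0) Q_0].
- by rewrite dw2 /dw phiE // scale1r mulKVmx ?inertia_unit.
- by rewrite dQ2 phiE // scale1r.
Qed.
End Existence.

(** * The virial function and instability *)

Section Instability.
Variable R : realType.
Implicit Types a b v w n : 'cV[R]_3.

Lemma norm_coord_le1 n i : dot n n = 1 -> `|n i 0| <= 1.
Proof.
move=> nn; rewrite -(@ler_pXn2r _ 2) // ?nnegrE // expr1n real_normK ?num_real //.
rewrite -nn /dot mxE (bigD1 i) //= !mxE -expr2 lerDl sumr_ge0 // => l _.
by rewrite mxE -expr2 sqr_ge0.
Qed.

Lemma dot_le a b (A B : R) : (forall i, `|a i 0| <= A) -> (forall i, `|b i 0| <= B) ->
  `|dot a b| <= 3 * (A * B).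
Proof.
move=> aA bB; rewrite /dot mxE; apply: le_trans (ler_norm_sum _ _ _) _.
apply: (@le_trans _ _ (\sum_(i < 3) A * B)).
  by apply: ler_sum => i _; rewrite mxE normrM ler_pM.
by rewrite sumr_const card_ord mulr_natl.
Qed.

Lemma cross_le a b (C : R) : (forall i j, `|a i 0 * b j 0| <= C) ->
  forall i, `|cross a b i 0| <= 2 * C.
Proof.
move=> abC i.
have main k l : `|a k 0 * b l 0 - a l 0 * b k 0| <= 2 * C.
  by apply: le_trans (ler_normB _ _) _; rewrite mulr_natl mulr2n lerD.
by case: i => -[|[|[|//]]] ?; rewrite mxE /=; apply: main.
Qed.

(** With [l = Jw], [a = gamma] and [rho = r *: n], the left side is the derivative of [l.(n x a)]
    along the motion. The last term vanishes at zero vertical momentum. *)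
Lemma virial_identity (l w n a : 'cV[R]_3) (k r : R) :
  dot (cross l w + k *: cross (r *: n) a) (cross n a) + dot l (cross n (cross a w))
    = dot (cross l w) (cross n a) + k * r * dot (cross n a) (cross n a)
      - dot n a * dot w l + dot l a * dot n w.
Proof. by rewrite !dotE !(mxE, crossE) /=; ring. Qed.

Lemma euclid_norm_sqr v : euclid_norm v ^+ 2 = dot v v.
Proof.
rewrite sqr_sqrtr ?sumr_ge0 // => [|i _]; last exact: sqr_ge0.
by rewrite /dot mxE; apply: eq_bigr => i _; rewrite mxE expr2.
Qed.

Lemma euclid_norm_gt0 v : v != 0 -> 0 < euclid_norm v.
Proof.
move=> v0; rewrite sqrtr_gt0 lt_neqAle sumr_ge0 ?andbT => [|i _]; last exact: sqr_ge0.
apply: contra v0; rewrite eq_sym psumr_eq0 => [/allP v0|i _]; last exact: sqr_ge0.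
apply/eqP/colP => i; rewrite mxE.
by have /(_ (mem_index_enum i)) := v0 i; rewrite sqrf_eq0 => /eqP.
Qed.

Lemma mx_entry_le p q (A : 'M[R]_(p, q)) i j : `|A i j| <= `|A|.
Proof.
by rewrite [leRHS]/Num.Def.normr /= mx_normrE; exact: (le_bigmax _ _ (i, j)).
Qed.

Variables (J : 'M[R]_3) (m g : R) (rho : 'cV[R]_3).
Hypotheses (hJ : sym_posdef J) (hm : 0 < m) (hg : 0 < g).

Lemma inverted_equilibrium x0 : inverted_equilibria rho x0 -> equilibrium J m g rho x0.
Proof.
move=> [SOx0 w0 Qe3] t t0 /=.
have derive_cst0 (V : normedModType R) (v : V) : derive1 (fun=> v) t = 0.
  by rewrite derive1E derive_cst.
split => //.
- rewrite derive_cst0 w0 Qe3 !mulmx0.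
  by apply: col3P; rewrite !(mxE, crossE) /=; ring.
- rewrite derive_cst0 w0; have -> : hat 0 = 0 :> 'M[R]_3; last by rewrite mulmx0.
  by apply/matrixP => i j; rewrite !mxE; case: i => -[|[|[|//]]] ? /=; rewrite ?mxE; ring.
Qed.

Lemma escape (r : R) (n : 'cV[R]_3) (Q0 : 'M[R]_3) (D eps : R) (x : R -> state R) :
    0 < r -> rho = r *: n -> dot n n = 1 ->
    Q0^T *m e3 = - n ->
    (forall v i, v i 0 ^+ 2 <= D * dot v (J *m v) /\
                 (J *m v) i 0 ^+ 2 <= D * dot v (J *m v)) ->
    0 < D -> 0 < eps -> eps <= 48^-1 -> D * eps <= 48^-1 ->
    trajectory J m g rho x -> (x 0).1 = Q0 -> (x 0).2 != 0 ->
    dot (J *m (x 0).2) n = 0 ->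
  exists2 t : R, 0 <= t & eps <= `|x t - (Q0, 0)|.
Proof.
move=> r0 rho_n nn Q0e3 DP D0 eps0 eps48 Deps48 trx xQ0 xw0 Jwn.
pose c := m * g * r; have c_gt0 : 0 < c by rewrite !mulr_gt0.
apply: contrapT => stay.
have close (t : R) : 0 <= t -> `|x t - (Q0, 0)| < eps.
  by move=> t0; rewrite ltNge; apply/negP => le; apply: stay; exists t.
pose Q t := (x t).1; pose w t := (x t).2; pose gam t := (Q t)^T *m e3.
have sol : reparametrized_solution J (m * g) rho Q w (fun=> 1).
  move=> t t0; have [_ dQ dw w' Q'] := trx t t0.
  exists (derive1 w t); rewrite !scale1r; split => //.
  - by apply/is_mderiveP; split => //; rewrite Q'.
  - by apply/is_mderiveP.
have QQ (t : R) : 0 <= t -> Q t *m (Q t)^T = 1%:M.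
  by move=> t0; have [[QQ _] _ _ _ _] := trx t t0; exact: mulmx1C.
have gam0 : gam 0 = - n by rewrite /gam /Q xQ0.
have gamgam (t : R) : 0 <= t -> dot (gam t) (gam t) = 1.
  move=> t0; rewrite /gam dot_mulmx trmxK mulmxA QQ // mul1mx /e3 dot_delta.
  by rewrite mxE !eqxx.
have mu (t : R) : 0 <= t -> dot (J *m w t) (gam t) = 0.
  move=> t0; rewrite (vertical_momentum_conserved sol t0) -/(gam 0) gam0.
  by rewrite dotNr Jwn oppr0.
pose T t := dot (w t) (J *m w t).
have T0 : 0 < T 0 by exact: kinetic_gt0.
have E (t : R) : 0 <= t -> T t = T 0 + 2 * c * (1 + dot n (gam t)).
  move=> t0; have := energy_conserved hJ sol t0.
  rewrite /energy -!/(gam _) -!/(T _) gam0 rho_n !(dotZl, dotNr) nn.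
  by rewrite /c; lra.
have gam_n (t : R) i : 0 <= t -> `|(gam t + n) i 0| <= eps.
  move=> t0; have -> : gam t + n = (Q t - Q0)^T *m e3.
    by rewrite linearB /= mulmxBl Q0e3 opprK.
  rewrite /e3 -colE !mxE; apply: le_trans (ltW (close t t0)).
  rewrite prod_normE le_max; apply/orP; left.
  by have := mx_entry_le (Q t - Q0) 2 i; rewrite !mxE.
have n1 i : `|n i 0| <= 1 by exact: norm_coord_le1.
(* The lower bound is [|gamma + n|^2 >= 0] for unit vectors; the upper one follows from
   [|n.(gamma + n)| <= 3 eps]. *)
have ngam (t : R) : 0 <= t -> -1 <= dot n (gam t) <= - 2^-1.
  move=> t0; have := dot_ge0 (gam t + n).
  have := dot_le n1 (gam_n t ^~ t0).
  rewrite !(dotDl, dotDr) nn gamgam // (dotC (gam t)) ler_norml mul1r.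
  move=> /andP[h1 h2] h3; apply/andP; split; lra.
have T_ge (t : R) : 0 <= t -> T 0 <= T t.
  move=> t0; rewrite (E t t0) lerDl mulr_ge0 //; first by rewrite mulr_ge0 // ltW.
  have /andP[] := ngam t t0; lra.
have arm (t : R) i : 0 <= t -> `|cross n (gam t) i 0| <= 2 * eps.
  move=> t0; have -> : cross n (gam t) = cross n (gam t + n).
    by apply: col3P; rewrite !(mxE, crossE) /=; ring.
  apply: cross_le => {}i j; rewrite normrM -[leRHS]mul1r.
  by apply: ler_pM => //; exact: gam_n.
pose V t := dot (J *m w t) (cross n (gam t)).
pose dV t := dot (torque J (m * g) rho (Q t) (w t)) (cross n (gam t))
  + dot (J *m w t) (cross n (cross (gam t) (w t))).
have dVP (t : R) : 0 <= t -> is_derive t 1 V (dV t).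
  move=> t0.
  have := is_derive_dot (is_mderive_momentum sol t0)
    (is_mderive_cross (is_mderive_cst n t) (is_mderive_body_vector sol e3 t0)).
  congr is_derive; rewrite !scale1r /dV; congr (_ + dot _ _).
  by apply: col3P; rewrite !(mxE, crossE) /=; ring.
(* The cubic term is at most [3 * (2 * D T) * (2 * eps) = 12 * D * eps * T], hence at most [T / 4]:
   this is where 48 comes from. The term [- (n.gamma) T] is at least [T / 2]. *)
have dV_ge (t : R) : 0 <= t -> 4^-1 * T 0 <= dV t.
  move=> t0; apply: le_trans (_ : 4^-1 * T t <= _).
    by rewrite ler_wpM2l ?T_ge // invr_ge0.
  rewrite /dV /torque -/(gam t) rho_n virial_identity mu //.
  rewrite mul0r addr0 -/c -/(T t).
  have T1 : 0 <= T t by apply: le_trans (T_ge t t0); exact: ltW.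
  have Jww i j : `|(J *m w t) i 0 * w t j 0| <= D * T t.
    have [_ h1] := DP (w t) i; have [h2 _] := DP (w t) j.
    rewrite -/(T t) in h1 h2; rewrite ler_norml.
    have := sqr_ge0 ((J *m w t) i 0 + w t j 0).
    have := sqr_ge0 ((J *m w t) i 0 - w t j 0).
    rewrite sqrrB sqrrD -mulr_natl => h3 h4; apply/andP; split; lra.
  have := dot_le (cross_le Jww) (arm t ^~ t0).
  have small : D * eps * T t <= 48^-1 * T t by rewrite ler_wpM2r.
  rewrite ler_norml => /andP[h1 _].
  have h2 : 0 <= c * dot (cross n (gam t)) (cross n (gam t)).
    by rewrite mulr_ge0 ?dot_ge0 // ltW.
  have h3 : 2^-1 * T t <= - dot n (gam t) * T t.
    by rewrite ler_wpM2r //; have /andP[] := ngam t t0; lra.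
  lra.
(* [E] gives [T t <= T 0 + 4 * c], which bounds [Jw]; the arm [n x gamma] has coordinates at most
   [2 * eps <= 1]. *)
have V_le (t : R) : 0 <= t -> `|V t| <= 3 * ((1 + D * (T 0 + 4 * c)) * 1).
  move=> t0; apply: dot_le => i; last first.
    by apply: le_trans (arm t i t0) _; lra.
  have [_] := DP (w t) i; rewrite -/(T t) (E t t0) => h.
  have {}h : (J *m w t) i 0 ^+ 2 <= D * (T 0 + 4 * c).
    apply: le_trans h _; rewrite ler_wpM2l ?(ltW D0) // lerD2l.
    rewrite (_ : 4 * c = 2 * c * 2); last by ring.
    rewrite ler_wpM2l ?mulr_ge0 // ?ltW //.
    by have /andP[] := ngam t t0; lra.
  have := sqr_ge0 (`|(J *m w t) i 0| - 1).
  rewrite sqrrB expr1n real_normK ?num_real //.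
  have := normr_ge0 ((J *m w t) i 0); lra.
set B := 3 * _ in V_le.
have B0 : 0 <= B by apply: le_trans (V_le 0 _).
(* By this time, growth at rate [T 0 / 4] exceeds [2 * B], the largest change that [|V| <= B]
   permits. *)
pose t := (2 * B + 1) / (4^-1 * T 0).
have k0 : 0 < 4^-1 * T 0 by rewrite mulr_gt0 // invr_gt0.
have t0 : 0 <= t by rewrite divr_ge0 ?(ltW k0) // addr_ge0 // mulr_ge0.
have [|s /andP[s0 _]] := @mean_value R V dV 0 t t0.
  by move=> s /andP[s0 _]; exact: dVP.
rewrite subr0 => VE.
have : 2 * B + 1 <= dV s * t.
  by rewrite -[leLHS](divfK (lt0r_neq0 k0)) mulrC ler_wpM2r // dV_ge.
have := V_le t t0; have := V_le 0 (lexx 0).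
rewrite !ler_norml => /andP[? ?] /andP[? ?]; lra.
Qed.

End Instability.

Theorem proposition3 (R : realType) (J : 'M[R]_3) (m g : R) (rho : 'cV[R]_3)
    (hJ : sym_posdef J) (hm : 0 < m) (hg : 0 < g) (hrho : rho != 0)
    (x0 : state R) (hx0 : inverted_equilibria rho x0) :
  unstable_equilibrium J m g rho x0.
Proof.
split; first exact: inverted_equilibrium.
move=> stable; case: x0 hx0 stable => Q0 w0 [/= SOQ0 -> Q0e3] stable.
have [D D0 DP] := kinetic_bound hJ.
(* Makes both [eps] and [D * eps] at most [1 / 48]. *)
pose eps : R := (48 * (1 + D))^-1.
have D1 : 0 < 48 * (1 + D) by rewrite mulr_gt0 // addr_gt0.
have eps0 : 0 < eps by rewrite invr_gt0.
have [delta delta0 stay] := stable _ eps0.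
(* Orthogonality of [u] to [J n] is, by symmetry of [J], that of [J u] to [n]: zero vertical
   momentum. *)
have [u u0 Jnu] := orthogonal_vector (J *m ((euclid_norm rho)^-1 *: rho)).
(* The initial velocity [s *: u] then has norm [delta / 2]. *)
pose s := delta / (2 * `|u|).
have nu : 0 < `|u| by rewrite normr_gt0.
have s0 : 0 < s by rewrite divr_gt0 // mulr_gt0.
have [x trx x_0] := @trajectory_exists R J m g rho hJ (Q0, s *: u) SOQ0.
have xw0 : (x 0).2 != 0 by rewrite x_0 /= scaler_eq0 negb_or u0 gt_eqF.
have Jwn : dot (J *m (x 0).2) ((euclid_norm rho)^-1 *: rho) = 0.
  by rewrite x_0 /= -dot_inertiaC // dotZl dotC Jnu mulr0.
have r0 := euclid_norm_gt0 hrho.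
have rho_n : rho = euclid_norm rho *: ((euclid_norm rho)^-1 *: rho).
  by rewrite scalerA mulfV ?scale1r // gt_eqF.
have nn : dot ((euclid_norm rho)^-1 *: rho) ((euclid_norm rho)^-1 *: rho) = 1.
  by rewrite dotZl dotZr -euclid_norm_sqr; field; rewrite gt_eqF.
have [|||t t0] := escape hJ hm hg r0 rho_n nn Q0e3 DP D0 eps0 _ _ trx _ xw0 Jwn.
- by rewrite lef_pV2 ?posrE // ler_peMr // lerDl ltW.
- rewrite /eps invfM mulrCA ler_piMr ?invr_ge0 //.
  by rewrite ler_pdivrMr ?addr_gt0 // mul1r lerDr.
- by rewrite x_0.
apply/negP; rewrite -ltNge; apply: stay => //.
have -> : x 0 - (Q0, 0) = (0, s *: u) :> state R.
  by rewrite x_0; congr pair; rewrite /= ?subrr ?subr0.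
rewrite prod_normE /= normr0 gt_max delta0 normrZ.
rewrite gtr0_norm //= /s invfM mulrA divfK ?gt_eqF //.
lra.
Qed.
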